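(* Let $n\ge 2$. Let $f=\frac1n\sum_{i=1}^n f_i:\mathbb{R}^d\to\mathbb{R}$ be convex and $L_f$-smooth with a nonempty set of minimizers, let $x^*$ be a fixed minimizer of $f$, and let each $f_i:\mathbb{R}^d\to\mathbb{R}$ be convex and $L$-smooth. Let $\mathcal{P}$ be the $\tau$-nice sampling with $\tau\in\{1,\dots,n\}$, assume $L_f+\frac{4L}{\tau}\cdot\frac{n-\tau}{n-1}>0$, and run Minibatch MISO with stepsize $\gamma=\frac{n}{2\tau\left(L_f+\frac{4L}{\tau}\cdot\frac{n-\tau}{n-1}\right)}$. Let $\mathcal{A}=\frac{n(n-\tau)}{\tau(n-1)}$ and $\mathcal{W}^0=\sum_{i=1}^n\|\phi_i^0-x^*-\gamma f_i'(\phi_i^0)+\gamma f_i'(x^* )\|^2$. If $x^a$ is chosen uniformly at random from $\{x^0,\dots,x^k\}$ (uniformly random index, independent of the algorithm's randomness), then for every $\epsilon>0$ and integer $k\ge 0$, $$k\ge 2\left(L_f+\frac{4L}{\tau}\cdot\frac{n-\tau}{n-1}\right)\frac{\|x^0-x^*\|^2+\frac{2\mathcal{A}\tau}{n^3}\mathcal{W}^0}{\epsilon}\quad\Longrightarrow\quad\mathbb{E}[f(x^a)]-f(x^* )\le\epsilon.$$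
   Context: A differentiable function is $L$-smooth if its gradient is Lipschitz with constant $L\ge 0$; $f'$ and $f_i'$ denote gradients. $\|\cdot\|$ is the Euclidean norm. $\tau$-nice sampling: the uniform distribution over the subsets of $\{1,\dots,n\}$ of cardinality $\tau$. Minibatch MISO with stepsize $\gamma>0$ and distribution $\mathcal{P}$ over subsets of $\{1,\dots,n\}$: given arbitrary deterministic $\phi_1^0,\dots,\phi_n^0\in\mathbb{R}^d$, set $x^0=\frac1n\sum_{i=1}^n\phi_i^0-\frac{\gamma}{n}\sum_{i=1}^n f_i'(\phi_i^0)$. For $k=0,1,\dots$: draw $S^k\sim\mathcal{P}$ independently of the past; set $\phi_i^{k+1}=x^k$ if $i\in S^k$ and $\phi_i^{k+1}=\phi_i^k$ if $i\notin S^k$; set $x^{k+1}=\frac1n\sum_{i=1}^n\phi_i^{k+1}-\frac{\gamma}{n}\sum_{i=1}^n f_i'(\phi_i^{k+1})$. *)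

(* Defs.v *)
From HB Require Import structures.
From mathcomp Require Export all_boot all_order all_algebra.
From mathcomp Require Export all_classical all_reals all_analysis.
Export Order.TTheory GRing.Theory Num.Theory numFieldNormedType.Exports.

Set Implicit Arguments.
Unset Strict Implicit.
Unset Printing Implicit Defensive.

Local Open Scope classical_set_scope.
Local Open Scope ring_scope.

Section Smoothness.
Variables (R : realType) (d : nat).
Implicit Types (x y : 'rV[R]_d) (f : 'rV[R]_d -> R).

(* The library norm on 'rV[R]_d is the sup norm. It is used only through the
   topology and the notion of differentiability, which do not depend on the
   choice of a norm. *)
Definition enorm x : R := Num.sqrt (\sum_(j < d) x 0 j ^+ 2).

Definition grad f x : 'rV[R]_d := \row_(j < d) ('d f x) (delta_mx 0 j).

Definition smooth (L : R) f : Prop :=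
  [/\ 0 <= L, forall x, differentiable f x &
      forall x y, enorm (grad f x - grad f y) <= L * enorm (x - y)].

Definition average n (fs : 'I_n -> 'rV[R]_d -> R) : 'rV[R]_d -> R :=
  fun x => n%:R^-1 * \sum_(i < n) fs i x.

End Smoothness.

(* All random variables below take values in a finite type, equipped with the
   discrete sigma-algebra. *)
Section DiscreteRandomVariables.
Variables (disp : measure_display) (T : measurableType disp) (R : realType).
Variable P : probability T R.

Definition discrete_rv (U : Type) (X : T -> U) : Prop :=
  forall A : set U, measurable (X @^-1` A).

Definition has_law (U : Type) (X : T -> U) (p : U -> R) : Prop :=
  forall u, P (X @^-1` [set u]) = (p u)%:E.

Definition sigma_of (U : Type) (J : set nat) (S : nat -> T -> U)
    : set (set T) :=
  <<s \bigcup_(j in J) preimage_set_system [set: T] (S j) [set: set U] >>.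

Definition independent_of (U : Type) (X : T -> U) (G : set (set T)) : Prop :=
  forall (A : set U) (B : set T), G B ->
    P (X @^-1` A `&` B) = (P (X @^-1` A) * P B)%E.

Definition independent_draws (U : Type) (p : U -> R) (S : nat -> T -> U)
    : Prop :=
  forall k, [/\ discrete_rv (S k), has_law (S k) p &
                independent_of (S k) (sigma_of `I_k S)].

End DiscreteRandomVariables.

Definition nice_sampling (R : realType) (n tau : nat) (s : {set 'I_n}) : R :=
  if #|s| == tau then ('C(n, tau))%:R^-1 else 0.

Definition uniform_index (R : realType) (k : nat) (i : 'I_k.+1) : R :=
  k.+1%:R^-1.

Section MISO.
Variables (R : realType) (d n : nat) (gamma : R).
Variable fs : 'I_n -> 'rV[R]_d -> R.

Definition miso_point (phi : 'I_n -> 'rV[R]_d) : 'rV[R]_d :=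
  n%:R^-1 *: (\sum_(i < n) phi i)
  - (gamma / n%:R) *: (\sum_(i < n) grad (fs i) (phi i)).

Fixpoint miso_phi (phi0 : 'I_n -> 'rV[R]_d) (S : nat -> {set 'I_n}) (k : nat)
    : 'I_n -> 'rV[R]_d :=
  if k is k'.+1 then
    let phi := miso_phi phi0 S k' in
    fun i => if i \in S k' then miso_point phi else phi i
  else phi0.

Definition miso_x (phi0 : 'I_n -> 'rV[R]_d) (S : nat -> {set 'I_n}) (k : nat)
    : 'rV[R]_d :=
  miso_point (miso_phi phi0 S k).

Definition miso_W (phi : 'I_n -> 'rV[R]_d) (xs : 'rV[R]_d) : R :=
  \sum_(i < n) enorm (phi i - xs - gamma *: grad (fs i) (phi i)
                      + gamma *: grad (fs i) xs) ^+ 2.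

End MISO.

(* Main.v *)
Require Import Defs.
From mathcomp Require Import perm ring lra.

Local Open Scope classical_set_scope.
Local Open Scope ring_scope.

(** Write [z_i = phi_i - gamma f_i'(phi_i)] for the quantities stored by the
method, so that [x] is their average, and [z_i^* = xs - gamma f_i'(xs)].
Drawing [s] replaces [z_i] by [x - gamma f_i'(x)] for [i] in [s].  On average
this moves [x] by a plain gradient step [- eta f'(x)] with
[eta = tau gamma / n = 1 / (2 M)]; the price is the variance of a sum over a
[tau]-subset, which is [tau (n - tau) / (n (n - 1))] times the sum of the
squared deviations of the increments from their mean.  Those deviations split
into a part due to [f_i'(x) - f_i'(xs)], controlled by [f x - f xs] through
cocoercivity, and a part due to [z_i - z_i^*], which is the quantity
[miso_W].  Its entries survive a step with probability [1 - tau / n] only, so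
adding it with the weight [B = 2 (n - tau) / (n^2 (n - 1))] to [|x - xs|^2]
gives a Lyapunov function ([miso_lyapunov]) in which the variance is absorbed.
The terms in [|x - xs|^2] that the refreshed entries of [miso_W] bring in cancel
exactly against the [n |x - xs|^2] gained by centring the [z_i - z_i^*].

What remains is the one-step bound [miso_expected_descent]: the conditional
expectation of the Lyapunov function drops by at least
[(2 M)^-1 (f x - f xs)], because
[- 2 eta + 2 eta^2 M = - eta] for [eta = 1 / (2 M)].  Summing over
[j = 0, ..., k] bounds the sum of the expected gaps by [2 M] times the initial
value of the Lyapunov function, and the uniform index turns that sum into an
average.

On the probabilistic side everything up to time [k] is a function of the
finite-valued history [(S 0, ..., S (k - 1))], so expectations are finite sums
and independence of [S k] (or of the index) from the past amounts to averaging
over its law first ([expectation_independent]). *)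

(** * Inner products and gradients *)

Definition dot {R : realType} {d : nat} (u v : 'rV[R]_d) : R :=
  \sum_(j < d) u 0 j * v 0 j.

Lemma dotC {R : realType} {d} (u v : 'rV[R]_d) : dot u v = dot v u.
Proof. by apply: eq_bigr => j _; rewrite mulrC. Qed.

Lemma dotDl {R : realType} {d} (u v w : 'rV[R]_d) :
  dot (u + v) w = dot u w + dot v w.
Proof. by rewrite -big_split; apply: eq_bigr => j _; rewrite mxE mulrDl. Qed.

Lemma dotZl {R : realType} {d} (c : R) (u v : 'rV[R]_d) :
  dot (c *: u) v = c * dot u v.
Proof. by rewrite mulr_sumr; apply: eq_bigr => j _; rewrite mxE mulrA. Qed.

Lemma dotBl {R : realType} {d} (u v w : 'rV[R]_d) :
  dot (u - v) w = dot u w - dot v w.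
Proof. by rewrite dotDl -scaleN1r dotZl mulN1r. Qed.

Lemma dotBr {R : realType} {d} (u v w : 'rV[R]_d) :
  dot w (u - v) = dot w u - dot w v.
Proof. by rewrite dotC dotBl !(dotC w). Qed.

Lemma dotDr {R : realType} {d} (u v w : 'rV[R]_d) :
  dot w (u + v) = dot w u + dot w v.
Proof. by rewrite dotC dotDl !(dotC w). Qed.

Lemma dotZr {R : realType} {d} (c : R) (u v : 'rV[R]_d) :
  dot u (c *: v) = c * dot u v.
Proof. by rewrite dotC dotZl dotC. Qed.

Lemma dot_ge0 {R : realType} {d} (u : 'rV[R]_d) : 0 <= dot u u.
Proof. by apply: sumr_ge0 => j _; rewrite -expr2 sqr_ge0. Qed.

Lemma dot_eq0 {R : realType} {d} (u : 'rV[R]_d) : dot u u = 0 -> u = 0.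
Proof.
move=> /eqP; rewrite psumr_eq0 => [/allP u0|j _];
  last by rewrite -expr2 sqr_ge0.
apply/rowP => j; rewrite mxE; apply/eqP; rewrite -sqrf_eq0 expr2.
exact: u0 (mem_index_enum j).
Qed.

Lemma enorm_sqr {R : realType} {d} (u : 'rV[R]_d) : enorm u ^+ 2 = dot u u.
Proof.
rewrite sqr_sqrtr; first by apply: eq_bigr => j _; rewrite expr2.
by apply: sumr_ge0 => j _; rewrite sqr_ge0.
Qed.

Lemma dot_sum_coord {R : realType} {d n} (u v : 'I_n -> 'rV[R]_d) :
  \sum_(i < n) dot (u i) (v i) = \sum_(j < d) \sum_(i < n) u i 0 j * v i 0 j.
Proof. exact: exchange_big. Qed.

(** Cauchy-Schwarz for a vector [u] known to be shorter than [K v]: expanding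
[|u - K v|^2 >= 0] gives it without square roots, except when [K = 0], where
[u] vanishes. *)
Lemma dot_le_of_sqnorm_le {R : realType} {d} (u v : 'rV[R]_d) (K : R) :
  0 <= K -> dot u u <= K ^+ 2 * dot v v -> dot u v <= K * dot v v.
Proof.
rewrite le_eqVlt => /orP[/eqP <-|K0] uv.
  have /dot_eq0 -> : dot u u = 0.
    by apply/eqP; rewrite eq_le dot_ge0 andbT; move: uv; rewrite expr0n mul0r.
  by rewrite mul0r /dot big1 // => j _; rewrite mxE mul0r.
have := dot_ge0 (u - K *: v).
rewrite !(dotBl, dotBr, dotZl, dotZr) (dotC v u) => H.
rewrite -(ler_pM2l K0); nra.
Qed.

Lemma diff_dot {R : realType} {d} (f : 'rV[R]_d -> R) (x v : 'rV[R]_d) :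
  differentiable f x -> 'd f x v = dot (grad f x) v.
Proof.
move=> df.
have -> : 'd f x v = 'd f x (\sum_j v 0 j *: delta_mx 0 j).
  by rewrite -row_sum_delta.
rewrite linear_sum; apply: eq_bigr => j _.
by rewrite linearZ /= /grad mxE mulrC.
Qed.

Lemma grad_average {R : realType} {d n} (fs : 'I_n -> 'rV[R]_d -> R) x :
  (forall i, differentiable (fs i) x) ->
  grad (average fs) x = n%:R^-1 *: \sum_(i < n) grad (fs i) x.
Proof.
move=> dfs; apply/rowP => j; rewrite !mxE summxE.
have E : average fs = n%:R^-1 \*: (\sum_(i < n) fs i).
  by apply/funext => z; rewrite /average fct_sumE.
have ds i : derivable (fs i) x (delta_mx 0 j) by exact: diff_derivable.
have da : differentiable (average fs) x.
  by rewrite E; apply: differentiableZ; apply: differentiable_sum.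
rewrite -deriveE // E deriveZ; last exact: derivable_sum.
rewrite derive_sum // /GRing.scale /=; congr (_ * _).
by apply: eq_bigr => i _; rewrite mxE deriveE.
Qed.

(** * Convex functions with Lipschitz gradient *)

Lemma is_derive_line {R : realType} {d} (f : 'rV[R]_d -> R) (x v : 'rV[R]_d)
    (t : R) :
  differentiable f (x + t *: v) ->
  is_derive t (1 : R) (fun s : R => f (x + s *: v))
    (dot (grad f (x + t *: v)) v).
Proof.
move=> df.
have E : (fun h : R => h^-1 *: (((fun s : R => f (x + s *: v)) \o shift t)
             (h *: (1 : R)) - f (x + t *: v))) =
   (fun h : R => h^-1 *: ((f \o shift (x + t *: v)) (h *: v)
                          - f (x + t *: v))).
  apply/funext => h /=; congr (_ *: (f _ - _)).
  by rewrite scalerDl /GRing.scale /= mulr1 addrCA addrA.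
split; rewrite /derivable /derive E; first exact: diff_derivable.
by rewrite -diff_dot // -deriveE.
Qed.

(** Convexity bounds every difference quotient of [f] at [x] towards [y] by
[f y - f x]; let the step tend to [0] from the right. *)
Lemma convex_gradient_inequality {R : realType} {d} (f : 'rV[R]_d -> R)
    (x y : 'rV[R]_d) :
  convex_function [set: 'rV[R]_d] f -> differentiable f x ->
  f x + dot (grad f x) (y - x) <= f y.
Proof.
move=> cf df; rewrite -lerBrDl -diff_dot // -deriveE //.
have /cvg_dnbhs_at_right D := diff_derivable (v := y - x) df.
rewrite /derive; apply: (cvgr_to_le D).
near=> h.
have h0 : 0 < h by near: h; exact: nbhs_right_gt.
have h1 : h <= 1 by near: h; exact: nbhs_right_le.
have := cf (Itv01 (ltW h0) h1) y x; rewrite !in_setT => /(_ isT isT).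
have -> : conv (Itv01 (ltW h0) h1) (y : convex_lmodType _) x
          = h *: (y - x) + x.
  by rewrite /conv /= /unstable.onem scalerBl scalerBr scale1r addrAC addrA.
rewrite convRE /= /unstable.onem => H.
rewrite /GRing.scale /= -ler_pdivlMl ?invr_gt0 // invrK.
by lra.
Unshelve. all: by end_near. Qed.

(** The mean value theorem is applied to [t |-> f (x + t v)] corrected by its
quadratic model, rather than to [f] itself: this is what yields the constant
[L / 2] without integrating. *)
Lemma descent {R : realType} {d} (f : 'rV[R]_d -> R) (L : R) (x v : 'rV[R]_d) :
  smooth L f -> f (x + v) <= f x + dot (grad f x) v + L / 2 * dot v v.
Proof.
move=> [L0 df lip].
pose g (t : R) : R := f (x + t *: v).
pose dg (t : R) : R := dot (grad f (x + t *: v)) v.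
pose h : R -> R :=
  g - dg 0 \*: (@idfun R) - (L / 2 * dot v v) \*: (@idfun R ^+ 2).
pose dh (t : R) := dg t - dg 0 - L * t * dot v v.
have dhP t : is_derive t (1 : R) h (dh t).
  have gP : is_derive t (1 : R) g (dg t) by exact: is_derive_line.
  have idP : is_derive t (1 : R) (@idfun R) 1 by exact: is_derive_id.
  have H := is_deriveB (is_deriveB gP (is_deriveZ (dg 0) idP))
    (is_deriveZ (L / 2 * dot v v) (is_deriveX 2 idP)).
  apply: (is_derive_eq H).
  rewrite /dh /GRing.scale /= expr1 !mulr1.
  move: (dg t) (dg 0) (dot v v) => a b e; by field.
have ch : {within `[0, 1], continuous h}.
  by apply: derivable_within_continuous => t _; exact: ex_derive.
have [c c01] := MVT_segment ler01 (fun t _ => dhP t) ch.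
have {}c01 : 0 <= c <= 1 by move: c01; rewrite in_itv.
have dgc : dg c - dg 0 <= L * c * dot v v.
  rewrite /dg -dotBl; apply: dot_le_of_sqnorm_le.
    by apply: mulr_ge0 => //; lra.
  have := lip (x + c *: v) (x + 0 *: v).
  rewrite -ler_sqr ?nnegrE ?mulr_ge0 ?sqrtr_ge0 // exprMn !enorm_sqr.
  rewrite scale0r addr0 (addrC x) addrK dotZl dotZr => /le_trans; apply.
  by rewrite le_eqVlt; apply/orP; left; apply/eqP; ring.
have hE t : h t = g t - dg 0 * t - L / 2 * dot v v * t ^+ 2 by [].
rewrite !hE /dh /g scale1r scale0r !addr0 expr1n expr0n /= => E.
have -> : grad f x = grad f (x + 0 *: v) by rewrite scale0r addr0.
move: dgc E; rewrite -/(dg 0).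
move: (dg c) (dg 0) (dot v v) (f _) (f _) => p q e a b; lra.
Qed.

(** The function [f - <grad f y, .>] is convex with minimizer [y]; one gradient
step of length [L^-1] from [x] cannot go below its minimum, while the descent
lemma says how far down it goes.  For [L = 0] the gradient is constant. *)
Lemma cocoercivity {R : realType} {d} (f : 'rV[R]_d -> R) (L : R)
    (x y : 'rV[R]_d) :
  convex_function [set: 'rV[R]_d] f -> smooth L f ->
  dot (grad f x - grad f y) (grad f x - grad f y)
    <= 2 * L * (f x - f y - dot (grad f y) (x - y)).
Proof.
move=> cf sf; have [L0 df lip] := sf.
set e := grad f x - grad f y.
have := L0; rewrite le_eqVlt => /orP[/eqP L00|Lp].
  have := lip x y; rewrite -L00 mul0r mulr0 mul0r -/e => e0.
  rewrite -enorm_sqr.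
  by have := sqrtr_ge0 (\sum_(j < d) e 0 j ^+ 2); rewrite -/(enorm e); nra.
(* x + v minimizes the quadratic upper model at x of f - <grad f y, .> *)
have [v vE] : exists v, v = - L^-1 *: e by exists (- L^-1 *: e).
have E1 : x + v - y = (x - y) + v by exact: addrAC.
have E2 := dotDr (x - y) v (grad f y).
have := convex_gradient_inequality f y (x + v) cf (df y).
rewrite E1 E2 => H0.
have := le_trans H0 (descent f L x v sf).
have : dot (grad f x) v - dot (grad f y) v = - L^-1 * dot e e.
  by rewrite -dotBl -/e vE dotZr.
have -> : L / 2 * dot v v = L^-1 / 2 * dot e e.
  by rewrite vE dotZl dotZr; move: (dot e e) => q; field; rewrite gt_eqF.
generalize (dot e e) (dot (grad f x) v) (dot (grad f y) v)
  (dot (grad f y) (x - y)) => q a b c.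
move: (f x) (f y) => fx fy H1 H2.
have H : L^-1 / 2 * q <= fx - fy - c by lra.
have -> : q = 2 * L * (L^-1 / 2 * q) by field; rewrite gt_eqF.
by rewrite ler_wpM2l // mulr_ge0.
Qed.

(** A short gradient step from a minimizer cannot decrease [f], while the
descent lemma makes it decrease unless the gradient vanishes. *)
Lemma grad_minimizer {R : realType} {d} (f : 'rV[R]_d -> R) (L : R)
    (x : 'rV[R]_d) :
  smooth L f -> (forall y, f x <= f y) -> grad f x = 0.
Proof.
move=> sf xmin; have [L0 _ _] := sf.
set g := grad f x.
(* L^-1 would do as a step length, but L may be 0. *)
pose c := (L + 1)^-1.
have c0 : 0 < c by rewrite invr_gt0; lra.
have cL : c * (L + 1) = 1 by rewrite mulVf // gt_eqF //; lra.
have := le_trans (xmin _) (descent f L x (- c *: g) sf).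
rewrite dotZr dotZl dotZr -/g => H.
have g0 : dot g g = 0.
  apply/eqP; rewrite eq_le dot_ge0 andbT.
  move: H; generalize (dot g g) => q H.
  rewrite -(pmulr_rle0 _ (_ : 0 < c * (1 + c)));
    last by rewrite mulr_gt0 ?addr_gt0.
  have : L * c * (c * q) = (1 - c) * (c * q) by congr (_ * _); lra.
  lra.
exact: dot_eq0.
Qed.

(** * First and second moments of nice sampling *)

Lemma nice_sampling_total {R : realType} {n tau : nat} :
  (tau <= n)%N -> \sum_s @nice_sampling R n tau s = 1.
Proof.
move=> tn; rewrite /nice_sampling -big_mkcond sumr_const /=.
have -> : #|[pred i : {set 'I_n} | #|i| == tau]| = 'C(n, tau).
  by rewrite -[in RHS](card_ord n) -card_draws cardsE.
by rewrite -[LHS]mulr_natr mulVf // pnatr_eq0 -lt0n bin_gt0.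
Qed.

Lemma nice_sampling_perm {R : realType} {n tau : nat} (t : {perm 'I_n})
    (F : {set 'I_n} -> R) :
  \sum_s nice_sampling R tau s * F s
    = \sum_s nice_sampling R tau s * F (t @: s)%SET.
Proof.
rewrite (reindex_inj (imset_inj (@perm_inj _ t))).
apply: eq_bigr => s _; congr (_ * _).
by rewrite /nice_sampling card_imset //; exact: perm_inj.
Qed.

Definition pair_inclusion (R : realType) {n : nat} (tau : nat) (i j : 'I_n)
    : R :=
  \sum_s nice_sampling R tau s * ((i \in s)%:R * (j \in s)%:R).

Lemma pair_inclusion_perm {R : realType} {n tau : nat} (t : {perm 'I_n}) i j :
  pair_inclusion R tau (t i) (t j) = pair_inclusion R tau i j.
Proof.
rewrite /pair_inclusion (nice_sampling_perm t); apply: eq_bigr => s _.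
by rewrite !(mem_imset _ _ (@perm_inj _ t)).
Qed.

Lemma sum_mem {R : realType} {n : nat} (s : {set 'I_n}) (v : 'I_n -> R) :
  \sum_(i in s) v i = \sum_i (i \in s)%:R * v i.
Proof.
rewrite big_mkcond; apply: eq_bigr => i _.
by case: (i \in s); rewrite ?mul1r ?mul0r.
Qed.

Lemma nice_sampling_card {R : realType} {n tau : nat} (s : {set 'I_n}) (c : R) :
  nice_sampling R tau s * (#|s|%:R * c) = nice_sampling R tau s * (tau%:R * c).
Proof. by rewrite /nice_sampling; case: eqP => [->|]; rewrite ?mul0r. Qed.

Lemma card_sum_mem {R : realType} {n : nat} (s : {set 'I_n}) :
  #|s|%:R = \sum_i (i \in s)%:R :> R.
Proof.
rewrite -sum1_card natr_sum sum_mem.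
by apply: eq_bigr => i _; rewrite mulr1.
Qed.

(** All indices have the same inclusion probability by symmetry, and these
probabilities add up to the expected cardinality [tau]. *)
Lemma inclusion_probability {R : realType} {n tau : nat} (i : 'I_n) :
  (tau <= n)%N -> pair_inclusion R tau i i = tau%:R / n%:R.
Proof.
move=> tn.
have n0 : n%:R != 0 :> R.
  by rewrite pnatr_eq0 -lt0n (leq_ltn_trans _ (ltn_ord i)).
apply: (canRL (mulfK n0)).
have E (j : 'I_n) : pair_inclusion R tau j j = pair_inclusion R tau i i.
  by rewrite -(pair_inclusion_perm (tperm i j)) tpermR.
have <- : \sum_(j < n) pair_inclusion R tau j j
          = pair_inclusion R tau i i * n%:R.
  rewrite (eq_bigr (fun=> pair_inclusion R tau i i)) => [|j _]; last exact: E.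
  by rewrite sumr_const card_ord mulr_natr.
transitivity (\sum_(s : {set 'I_n}) nice_sampling R tau s * tau%:R); last first.
  by rewrite -mulr_suml nice_sampling_total // mul1r.
rewrite exchange_big; apply: eq_bigr => s _.
rewrite -[tau%:R]mulr1 -nice_sampling_card mulr1.
rewrite card_sum_mem mulr_sumr; apply: eq_bigr => j _.
by case: (j \in s); rewrite ?mulr1 ?mulr0.
Qed.

(** For fixed [i], the probability of drawing [i] and [l] together is the same
for all [l] other than [i], and summing over all [l] counts [tau] elements each
time [i] is drawn. *)
Lemma pair_inclusion_neq {R : realType} {n tau : nat} (i j : 'I_n) :
  (tau <= n)%N -> i != j ->
  pair_inclusion R tau i j
    = tau%:R * (tau%:R - 1) / (n%:R * (n%:R - 1)).
Proof.
move=> tn ij.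
have n0 : n%:R != 0 :> R.
  by rewrite pnatr_eq0 -lt0n (leq_ltn_trans _ (ltn_ord i)).
have n2 : (1 < n)%N.
  move: ij; rewrite -(inj_eq val_inj) /=.
  by case: n i j {tn n0} => [|[|n]] // [[|i] ?] [[|j] ?].
have n1 : n%:R - 1 != 0 :> R.
  by rewrite subr_eq0 pnatr_eq1; case: ltngtP n2.
have E (l : 'I_n) :
    l != i -> pair_inclusion R tau i l = pair_inclusion R tau i j.
  move=> li; rewrite -(pair_inclusion_perm (tperm j l)) tpermR tpermD //.
  by rewrite eq_sym.
have : \sum_(l < n) pair_inclusion R tau i l = tau%:R * (tau%:R / n%:R).
  rewrite -(inclusion_probability i tn) mulr_sumr exchange_big.
  apply: eq_bigr => s _.
  rewrite -!mulr_sumr -card_sum_mem (mulrC _ #|s|%:R) nice_sampling_card.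
  by rewrite mulrCA; case: (i \in s); rewrite ?mulr1 ?mulr0.
rewrite (bigD1 i) //= inclusion_probability //.
rewrite (eq_bigr (fun=> pair_inclusion R tau i j));
  last exact: E.
rewrite sumr_const cardC1 card_ord -(mulr_natr (pair_inclusion R tau i j)).
rewrite -subn1 natrB ?(ltnW n2) // => H.
have : pair_inclusion R tau i j * (n%:R - 1)
  = tau%:R * (tau%:R / n%:R) - tau%:R / n%:R.
  by rewrite -H; ring.
by move=> /(canRL (mulfK n1)) ->; field; rewrite n0 n1.
Qed.

Lemma nice_sampling_mean {R : realType} {n tau : nat} (v : 'I_n -> R) :
  (tau <= n)%N ->
  \sum_s nice_sampling R tau s * \sum_(i in s) v i
    = tau%:R / n%:R * \sum_i v i.
Proof.
move=> tn; under eq_bigr do rewrite sum_mem mulr_sumr.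
rewrite exchange_big mulr_sumr; apply: eq_bigr => i _.
rewrite -(inclusion_probability i tn) mulr_suml; apply: eq_bigr => s _.
by case: (i \in s); rewrite ?mul1r ?mul0r ?mulr1 ?mulr0 ?mul0r.
Qed.

(** For a centred family the off-diagonal part of the square, where the pair
probabilities are constant, contributes minus its diagonal; so only the
difference of the two inclusion probabilities survives. *)
Lemma nice_sampling_variance {R : realType} {n tau : nat} (v : 'I_n -> R) :
  (tau <= n)%N -> (1 < n)%N -> \sum_i v i = 0 ->
  \sum_s nice_sampling R tau s * (\sum_(i in s) v i) ^+ 2
    = tau%:R * (n%:R - tau%:R) / (n%:R * (n%:R - 1)) * \sum_i v i ^+ 2.
Proof.
move=> tn n2 v0.
have n0 : n%:R != 0 :> R by rewrite pnatr_eq0 -lt0n ltnW.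
have n1 : n%:R - 1 != 0 :> R.
  by rewrite subr_eq0 pnatr_eq1; case: ltngtP n2.
set r := tau%:R * (tau%:R - 1) / (n%:R * (n%:R - 1)) : R.
have E (i : 'I_n) :
    \sum_j v j * pair_inclusion R tau i j = (tau%:R / n%:R - r) * v i.
  rewrite (bigD1 i) //= inclusion_probability //.
  rewrite (eq_bigr (fun j => v j * r)) => [|j ji]; last first.
    by rewrite pair_inclusion_neq // eq_sym.
  move: v0; rewrite -mulr_suml (bigD1 i) //= => /eqP.
  rewrite addrC addr_eq0 => /eqP ->.
  ring.
have -> : tau%:R * (n%:R - tau%:R) / (n%:R * (n%:R - 1)) = tau%:R / n%:R - r.
  by rewrite /r; field; rewrite n0 n1.
rewrite mulr_sumr.
transitivity (\sum_i v i * \sum_j v j * pair_inclusion R tau i j); last first.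
  by apply: eq_bigr => i _; rewrite E expr2 mulrCA.
under eq_bigr do rewrite sum_mem expr2 mulr_suml mulr_sumr.
rewrite exchange_big; apply: eq_bigr => i _.
under eq_bigr do rewrite !mulr_sumr.
rewrite exchange_big mulr_sumr; apply: eq_bigr => j _.
by rewrite /pair_inclusion !mulr_sumr; apply: eq_bigr => s _; ring.
Qed.

(** * One step of the method *)

(** All quantities of the one-step analysis are sums over coordinates, so the
expected change of the Lyapunov function is computed for scalars.  With
[v_i = u_i - mean u] for the increments [u_i = x - gamma g_i - z_i], the new
point minus [o] is [x - o - eta gm] plus the mean-zero contribution of the [v_i]
with [i] drawn.  The deviation [v_i] is then split into the deviations of the
two families [gamma (gs_i - g_i)] and [z_i - (o - gamma gs_i)], by
[(a - b)^2 <= 2 a^2 + 2 b^2]. *)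
Lemma miso_coordinate_step {R : realType} {n tau : nat} (gamma o x gm B : R)
    (z g gs : 'I_n -> R) (N := n%:R : R) (t := tau%:R : R)
    (z' := fun (s : {set 'I_n}) i => if i \in s then x - gamma * g i else z i) :
  (1 <= tau <= n)%N -> (1 < n)%N ->
  x = N^-1 * \sum_i z i -> gm = N^-1 * \sum_i g i -> \sum_i gs i = 0 ->
  B = 2 * (N - t) / (N ^+ 2 * (N - 1)) ->
  \sum_s nice_sampling R tau s *
     ((N^-1 * (\sum_i z' s i) - o) ^+ 2
      + B * \sum_i (z' s i - (o - gamma * gs i)) ^+ 2)
  <= (x - o) ^+ 2 + B * \sum_i (z i - (o - gamma * gs i)) ^+ 2
     - 2 * (t * gamma / N + B * t * gamma) * (gm * (x - o))
     + (t * gamma / N) ^+ 2 * gm ^+ 2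
     + 2 * (B * t / N) * gamma ^+ 2 * \sum_i (g i - gs i) ^+ 2.
Proof.
move=> /andP[t1 tn] n2 hx hgm gs0 hB.
have N2 : 2 <= N by rewrite /N ler_nat.
have tN : t <= N by rewrite /N /t ler_nat.
have T1 : 1 <= t by rewrite /t (ler_nat _ 1).
have N0 : N != 0 by rewrite gt_eqF //; lra.
have N1 : N - 1 != 0 by rewrite gt_eqF //; lra.
have t0 : t != 0 by rewrite gt_eqF //; lra.
(* c is the variance factor of nice sampling divided by N ^+ 2, as the point is
   a mean of n entries. *)
pose c := t * (N - t) / (N ^+ 3 * (N - 1)).
have BE : B = 2 * c * N / t by rewrite hB /c; field; rewrite N0 N1 t0.
have c0 : 0 <= c.
  by rewrite /c divr_ge0 // ?mulr_ge0 // ?exprn_ge0 //; lra.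
have sumz : \sum_i z i = N * x by rewrite hx mulVKf.
have sumg : \sum_i g i = N * gm by rewrite hgm mulVKf.
have sum1 (a : R) : \sum_(i < n) a = N * a.
  by rewrite sumr_const card_ord -mulr_natl.
(* v i is the increment of entry i, minus the mean increment - gamma * gm. *)
pose v i := x - gamma * g i - z i + gamma * gm.
have v0 : \sum_i v i = 0.
  by rewrite !(big_split, sumrN) /= !sum1 -mulr_sumr sumz sumg; ring.
have z'E s i : z' s i = z i + (i \in s)%:R * (v i - gamma * gm).
  by rewrite /z' /v; case: (i \in s); rewrite ?mul1r ?mul0r; ring.
have step s : N^-1 * (\sum_i z' s i) - o
  = (x - o) + N^-1 * (\sum_(i in s) v i) - N^-1 * gamma * gm * #|s|%:R.
  under eq_bigr do rewrite z'E mulrBr.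
  by rewrite big_split /= sumrB -sum_mem -mulr_suml -card_sum_mem sumz; field.
have EX : \sum_s nice_sampling R tau s * (N^-1 * (\sum_i z' s i) - o) ^+ 2
  = (x - o - t * gamma / N * gm) ^+ 2 + c * \sum_i v i ^+ 2.
  pose y := x - o - t * gamma / N * gm.
  rewrite (eq_bigr (fun s => nice_sampling R tau s * y ^+ 2
     + (2 * y / N) * (nice_sampling R tau s * \sum_(i in s) v i)
     + N^-1 ^+ 2 * (nice_sampling R tau s * (\sum_(i in s) v i) ^+ 2))).
    rewrite !big_split /= -!mulr_sumr -mulr_suml nice_sampling_total //.
    rewrite nice_sampling_mean // nice_sampling_variance // v0 -/y -/N -/t /c.
    by field; rewrite ?N0 ?N1 ?t0.
  move=> s _; rewrite step /nice_sampling.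
  case: eqP => [->|_]; last by rewrite !mul0r !mulr0 !addr0.
  by rewrite -/t /y; set p := _%:R^-1; set w := \sum_(i in s) v i; field.
have EW : \sum_s nice_sampling R tau s *
            \sum_i (z' s i - (o - gamma * gs i)) ^+ 2
  = t / N * (\sum_i (x - gamma * g i - (o - gamma * gs i)) ^+ 2)
    + (1 - t / N) * \sum_i (z i - (o - gamma * gs i)) ^+ 2.
  pose b i := (z i - (o - gamma * gs i)) ^+ 2.
  pose a i := (x - gamma * g i - (o - gamma * gs i)) ^+ 2.
  rewrite (eq_bigr (fun s => nice_sampling R tau s * (\sum_i b i)
     + nice_sampling R tau s * \sum_(i in s) (a i - b i))).
    rewrite big_split /= -mulr_suml nice_sampling_total //.
    rewrite nice_sampling_mean //.
    by rewrite sumrB -/N -/t -/a -/b; ring.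
  move=> s _; rewrite -mulrDr sum_mem -big_split; congr (_ * _).
  apply: eq_bigr => i _ /=; rewrite /z' /a /b.
  by case: (i \in s); rewrite ?mul1r ?mul0r; ring.
pose b i := z i - (o - gamma * gs i).
have sumb : \sum_i b i = N * (x - o).
  by rewrite /b !sumrB !sum1 -mulr_sumr gs0 sumz; ring.
set G := \sum_i (g i - gs i) ^+ 2.
set W := \sum_i (z i - (o - gamma * gs i)) ^+ 2 in EW *.
have EA : \sum_i (x - gamma * g i - (o - gamma * gs i)) ^+ 2
  = N * (x - o) ^+ 2 - 2 * gamma * (x - o) * (N * gm) + gamma ^+ 2 * G.
  rewrite (eq_bigr (fun i => (x - o) ^+ 2 - 2 * gamma * (x - o) * (g i - gs i)
                             + gamma ^+ 2 * (g i - gs i) ^+ 2)).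
    by rewrite !big_split /= sumrN -!mulr_sumr sum1 sumrB gs0 sumg -/G; ring.
  by move=> i _; ring.
have EV : \sum_i v i ^+ 2 <= 2 * (gamma ^+ 2 * (G - N * gm ^+ 2))
                             + 2 * (W - N * (x - o) ^+ 2).
  have -> : gamma ^+ 2 * (G - N * gm ^+ 2)
            = \sum_i (gamma * gm - gamma * (g i - gs i)) ^+ 2.
    rewrite (eq_bigr (fun i => gamma ^+ 2 * gm ^+ 2
        - 2 * gamma ^+ 2 * gm * (g i - gs i) + gamma ^+ 2 * (g i - gs i) ^+ 2)).
      by rewrite !big_split /= sumrN -!mulr_sumr sum1 sumrB gs0 sumg /G; ring.
    by move=> i _; ring.
  have -> : W - N * (x - o) ^+ 2 = \sum_i (b i - (x - o)) ^+ 2.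
    rewrite (eq_bigr (fun i => b i ^+ 2 - 2 * (x - o) * b i + (x - o) ^+ 2)).
      by rewrite !big_split /= sumrN -!mulr_sumr sum1 sumb /W /b; ring.
    by move=> i _; ring.
  rewrite !mulr_sumr -big_split; apply: ler_sum => i _ /=.
  (* 2 p^2 + 2 q^2 - (p - q)^2 = (p + q)^2 *)
  rewrite -subr_ge0.
  apply: le_trans
    (sqr_ge0 (gamma * gm - gamma * (g i - gs i) + (b i - (x - o)))) _.
  by rewrite le_eqVlt /v /b; apply/orP; left; apply/eqP; ring.
rewrite (eq_bigr (fun s =>
    nice_sampling R tau s * (N^-1 * (\sum_i z' s i) - o) ^+ 2
    + B * (nice_sampling R tau s
           * \sum_i (z' s i - (o - gamma * gs i)) ^+ 2))); last first.
  by move=> s _; rewrite mulrDr; congr (_ + _); rewrite mulrCA.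
rewrite big_split -mulr_sumr /= EX EW EA BE.
set V := \sum_i v i ^+ 2 in EV *.
have := ler_wpM2l c0 EV.
have : 0 <= c * N * gamma ^+ 2 * gm ^+ 2.
  by do 3!(apply: mulr_ge0; rewrite ?sqr_ge0 //); lra.
(* The 2 c W lost by W in a step pays for the 2 c W in the variance. *)
have -> : 2 * c * N / t
    * (t / N * (N * (x - o) ^+ 2 - 2 * gamma * (x - o) * (N * gm)
                + gamma ^+ 2 * G) + (1 - t / N) * W)
  = 2 * c * (N * (x - o) ^+ 2 - 2 * gamma * (x - o) * (N * gm)
             + gamma ^+ 2 * G) + 2 * c * N / t * W - 2 * c * W.
  by field; rewrite ?N0 ?t0.
have -> : 2 * (t * gamma / N + 2 * c * N / t * t * gamma)
  = 2 * (t * gamma / N) + 4 * c * N * gamma.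
  by field; rewrite ?N0 ?t0.
have -> : 2 * (2 * c * N / t * t / N) = 4 * c by field; rewrite ?N0 ?t0.
lra.
Qed.

Definition miso_step {R : realType} {d n : nat} (gamma : R)
    (fs : 'I_n -> 'rV[R]_d -> R) (phi : 'I_n -> 'rV[R]_d) (s : {set 'I_n}) :
    'I_n -> 'rV[R]_d :=
  fun i => if i \in s then miso_point gamma fs phi else phi i.

Definition miso_lyapunov {R : realType} {d n : nat} (gamma B : R)
    (fs : 'I_n -> 'rV[R]_d -> R) (xs : 'rV[R]_d) (phi : 'I_n -> 'rV[R]_d) : R :=
  enorm (miso_point gamma fs phi - xs) ^+ 2 + B * miso_W gamma fs phi xs.

Lemma miso_point_coord {R : realType} {d n : nat} (gamma : R)
    (fs : 'I_n -> 'rV[R]_d -> R) (phi : 'I_n -> 'rV[R]_d) (j : 'I_d) :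
  miso_point gamma fs phi 0 j
    = n%:R^-1 * \sum_i (phi i 0 j - gamma * grad (fs i) (phi i) 0 j).
Proof.
rewrite /miso_point !mxE !summxE sumrB -mulr_sumr mulrBr mulrA.
by rewrite (mulrC gamma).
Qed.

Lemma miso_lyapunov_coord {R : realType} {d n : nat} (gamma B : R)
    (fs : 'I_n -> 'rV[R]_d -> R) (xs : 'rV[R]_d) (phi : 'I_n -> 'rV[R]_d) :
  miso_lyapunov gamma B fs xs phi
    = \sum_j ((n%:R^-1 * (\sum_i (phi i 0 j - gamma * grad (fs i) (phi i) 0 j))
               - xs 0 j) ^+ 2
       + B * \sum_i (phi i 0 j - gamma * grad (fs i) (phi i) 0 j
                     - (xs 0 j - gamma * grad (fs i) xs 0 j)) ^+ 2).
Proof.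
rewrite big_split -mulr_sumr exchange_big /=; congr (_ + _ * _).
  rewrite enorm_sqr; apply: eq_bigr => j _.
  rewrite -miso_point_coord expr2.
  by generalize (miso_point gamma fs phi) => u; rewrite !mxE.
apply: eq_bigr => i _; rewrite enorm_sqr; apply: eq_bigr => j _.
rewrite -expr2; congr (_ ^+ 2).
generalize (grad (fs i) (phi i)) (grad (fs i) xs) (phi i) => u v w.
by rewrite !mxE; ring.
Qed.

(** After summing the coordinate bound, convexity bounds
[<f'(x), x - xs>] below by the gap [f x - f xs], and cocoercivity bounds
[|f'(x)|^2] and the sum of [|f_i'(x) - f_i'(xs)|^2] above by multiples of it;
the linear terms of the latter cancel since the [f_i'(xs)] sum to [0].  The
constant [M] is exactly the one for which these contributions balance at
[eta = (2 M)^-1]. *)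
Lemma miso_expected_descent {R : realType} {d n : nat}
    (fs : 'I_n -> 'rV[R]_d -> R) (Lf L : R) (xs : 'rV[R]_d) (tau : nat)
    (M gamma B : R) (phi : 'I_n -> 'rV[R]_d) (f := average fs)
    (N := n%:R : R) (t := tau%:R : R) :
  (2 <= n)%N -> (1 <= tau <= n)%N ->
  convex_function [set: 'rV[R]_d] f -> smooth Lf f ->
  (forall x, f xs <= f x) ->
  (forall i, convex_function [set: 'rV[R]_d] (fs i)) ->
  (forall i, smooth L (fs i)) ->
  M = Lf + 4 * L / t * ((N - t) / (N - 1)) -> 0 < M ->
  gamma = N / (2 * t * M) ->
  B = 2 * (N - t) / (N ^+ 2 * (N - 1)) ->
  \sum_s nice_sampling R tau s
     * miso_lyapunov gamma B fs xs (miso_step gamma fs phi s)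
  <= miso_lyapunov gamma B fs xs phi
     - (2 * M)^-1 * (f (miso_point gamma fs phi) - f xs).
Proof.
move=> n2 tn cf sf fmin cfs sfs hM M0 hgamma hB.
have /andP[t1' tn'] := tn.
have N2 : 2 <= N by rewrite /N ler_nat.
have tN : t <= N by rewrite /N /t ler_nat.
have T1 : 1 <= t by rewrite /t (ler_nat _ 1).
have N0 : N != 0 by rewrite gt_eqF //; lra.
have N1 : N - 1 != 0 by rewrite gt_eqF //; lra.
have t0 : t != 0 by rewrite gt_eqF //; lra.
have Mn0 : M != 0 by rewrite gt_eqF.
have dfs i y : differentiable (fs i) y by have [_ + _] := sfs i; apply.
have gavg y : grad f y = N^-1 *: \sum_i grad (fs i) y by exact: grad_average.
have gxs : grad f xs = 0 by exact: (grad_minimizer f Lf).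
have sumgs j : \sum_i grad (fs i) xs 0 j = 0.
  move: gxs; rewrite gavg => /rowP /(_ j).
  rewrite [LHS]mxE [RHS]mxE summxE => /eqP.
  by rewrite mulf_eq0 invr_eq0 (negbTE N0) => /eqP.
have [x xE] : exists x, x = miso_point gamma fs phi.
  by exists (miso_point gamma fs phi).
have xjE j :
    x 0 j = N^-1 * \sum_i (phi i 0 j - gamma * grad (fs i) (phi i) 0 j).
  by rewrite xE miso_point_coord.
have gmE j : grad f x 0 j = N^-1 * \sum_i grad (fs i) x 0 j.
  by rewrite gavg [LHS]mxE summxE.
have step j := @miso_coordinate_step R n tau gamma (xs 0 j) (x 0 j)
   (grad f x 0 j) B
   (fun i => phi i 0 j - gamma * grad (fs i) (phi i) 0 j)
   (fun i => grad (fs i) x 0 j) (fun i => grad (fs i) xs 0 j) tn n2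
   (xjE j) (gmE j) (sumgs j) hB.
rewrite -xE.
have F1 : f x - f xs <= dot (grad f x) (x - xs).
  have [_ df _] := sf.
  have := convex_gradient_inequality f x xs cf (df x).
  rewrite (dotBr xs x) (dotBr x xs).
  generalize (dot (grad f x) xs) (dot (grad f x) x) (f x) (f xs) => a b p q.
  lra.
have F0 : 0 <= f x - f xs by rewrite subr_ge0.
have F2 : dot (grad f x) (grad f x) <= 2 * Lf * (f x - f xs).
  have := cocoercivity f Lf x xs cf sf; rewrite gxs subr0.
  have -> : dot 0 (x - xs) = 0 by apply: big1 => j _; rewrite mxE mul0r.
  by rewrite subr0.
pose e i := grad (fs i) x - grad (fs i) xs.
have F3 : \sum_i dot (e i) (e i) <= 2 * L * N * (f x - f xs).
  apply: le_trans
    (ler_sum _ (fun i _ => cocoercivity (fs i) L x xs (cfs i) (sfs i))) _.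
  rewrite -mulr_sumr !sumrB.
  have -> : \sum_i dot (grad (fs i) xs) (x - xs) = 0.
    rewrite exchange_big big1 // => j _.
    by rewrite -mulr_suml sumgs mul0r.
  by rewrite subr0 /f /average -mulrBr -/N mulrA -(mulrA _ N) mulfV // mulr1.
have main : \sum_s nice_sampling R tau s
     * miso_lyapunov gamma B fs xs (miso_step gamma fs phi s)
   <= miso_lyapunov gamma B fs xs phi
   - 2 * (t * gamma / N + B * t * gamma) * dot (grad f x) (x - xs)
   + (t * gamma / N) ^+ 2 * dot (grad f x) (grad f x)
   + 2 * (B * t / N) * gamma ^+ 2 * \sum_i dot (e i) (e i).
  rewrite miso_lyapunov_coord (dot_sum_coord e e) /dot.
  rewrite !mulr_sumr -sumrB -!big_split /=.
  under eq_bigr do rewrite miso_lyapunov_coord mulr_sumr.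
  rewrite exchange_big; apply: ler_sum => j _ /=.
  apply: (le_trans _ (le_trans (step j) _)).
    apply: ler_sum => s _; rewrite le_eqVlt; apply/orP; left; apply/eqP.
    have E i : miso_step gamma fs phi s i 0 j
        - gamma * grad (fs i) (miso_step gamma fs phi s i) 0 j
      = if i \in s then x 0 j - gamma * grad (fs i) x 0 j
        else phi i 0 j - gamma * grad (fs i) (phi i) 0 j.
      by rewrite /miso_step -xE; case: ifP.
    by under eq_bigr do rewrite E; under [X in B * X]eq_bigr do rewrite E.
  have E i : e i 0 j = grad (fs i) x 0 j - grad (fs i) xs 0 j.
    by rewrite /e; generalize (grad (fs i) x) => u; rewrite !mxE.
  have E' : (x - xs) 0 j = x 0 j - xs 0 j by rewrite !mxE.
  under [X in _ <= _ + _ * X]eq_bigr do rewrite E -expr2.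
  by rewrite -/N -xjE E' -expr2.
apply: (le_trans main).
have eta : t * gamma / N = (2 * M)^-1.
  by rewrite hgamma; field; rewrite N0 t0 Mn0.
have B0 : 0 <= B.
  by rewrite hB divr_ge0 // ?mulr_ge0 // ?exprn_ge0 //; lra.
have g0 : 0 < gamma.
  rewrite hgamma divr_gt0 //; first lra.
  by rewrite mulr_gt0 // mulr_gt0 //; lra.
have eta0 : 0 < (2 * M)^-1 by rewrite invr_gt0 mulr_gt0.
rewrite -addrA -addrA lerD2l.
move: F1 F0 F2 F3; rewrite eta.
generalize (f x - f xs) (dot (grad f x) (x - xs)) (dot (grad f x) (grad f x))
  (\sum_i dot (e i) (e i)) => D d1 G H F1 F0 F2 F3.
have I1 : 2 * (2 * M)^-1 * D <= 2 * ((2 * M)^-1 + B * t * gamma) * d1.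
  have : 0 <= B * t * gamma by rewrite !mulr_ge0 //; lra.
  generalize (B * t * gamma) (2 * M)^-1 eta0 => q r; clear -F1 F0; nra.
have I2 := ler_wpM2l (sqr_ge0 (2 * M)^-1) F2.
have c4 : 0 <= 2 * (B * t / N) * gamma ^+ 2.
  by rewrite mulr_ge0 ?sqr_ge0 // mulr_ge0 // divr_ge0 ?mulr_ge0 //; lra.
have I3 := ler_wpM2l c4 F3.
have I4 : (2 * M)^-1 ^+ 2 * (2 * Lf * D)
    + 2 * (B * t / N) * gamma ^+ 2 * (2 * L * N * D) = (2 * M)^-1 * D.
  have -> : Lf = M - 4 * L / t * ((N - t) / (N - 1)) by rewrite hM addrK.
  by rewrite hB hgamma; field; rewrite N0 N1 t0 Mn0.
lra.
Qed.

(** * Expectations of functions of finite histories *)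

Lemma expectation_finite_valued {disp} {T : measurableType disp} {R : realType}
    (P : probability T R) {U : finType} (Y : T -> U) (g : U -> R) :
  (forall u, measurable (Y @^-1` [set u])) ->
  'E_P[fun w => g (Y w)]%E
    = (\sum_u g u * fine (P (Y @^-1` [set u])))%:E.
Proof.
move=> mY; rewrite unlock.
have iY u : P.-integrable setT (fun w => (\1_(Y @^-1` [set u]) w)%:E : \bar R).
  exact: integrable_indic.
transitivity (\int[P]_w (\sum_u (g u)%:E * (\1_(Y @^-1` [set u]) w)%:E))%E.
  apply: eq_integral => w _; rewrite (bigD1 (Y w)) //= big1 ?adde0.
    by rewrite indicE mem_set // mule1.
  move=> u uY; rewrite indicE memNset ?mule0 // => /= Yu.
  by rewrite Yu eqxx in uY.
rewrite integral_sum //; last by move=> u; exact: integrableZl.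
rewrite -sumEFin; apply: eq_bigr => u _.
rewrite integralZl // integral_indic // setIT EFinM fineK //.
exact: fin_num_measure.
Qed.

(** Only the atoms of [Y] have to belong to the family [G] of which [X] is
independent, since [U] and [V] are finite: the joint law is then the product
of the laws, and the law of [X] can be summed out first. *)
Lemma expectation_independent {disp} {T : measurableType disp} {R : realType}
    (P : probability T R) {U V : finType} (X : T -> U) (Y : T -> V)
    (p : U -> R) (G : set (set T)) (g : U -> V -> R) :
  discrete_rv X -> has_law P X p -> independent_of P X G ->
  G `<=` measurable -> (forall v, G (Y @^-1` [set v])) ->
  'E_P[fun w => g (X w) (Y w)]%E
    = 'E_P[fun w => (\sum_u p u * g u (Y w))%R]%E.
Proof.
move=> mX lawX indX mG GY.
have XY u v : (fun w => (X w, Y w)) @^-1` [set (u, v)]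
              = X @^-1` [set u] `&` Y @^-1` [set v].
  by apply/seteqP; split => w /= => [[-> ->]|[-> ->]].
rewrite (expectation_finite_valued P (fun w => (X w, Y w))
  (fun z => g z.1 z.2)).
  rewrite (expectation_finite_valued P Y (fun v => \sum_u p u * g u v)).
    congr (_%:E); under [RHS]eq_bigr do rewrite mulr_suml.
    rewrite exchange_big pair_big /=; apply: eq_bigr => -[u v] _ /=.
    rewrite XY indX // lawX fineM //; last exact: fin_num_measure (mG _ _).
    by rewrite /= mulrCA mulrA.
  by move=> v; exact: mG.
by move=> [u v]; rewrite XY; apply: measurableI; [exact: mX|exact: mG].
Qed.

Lemma sigma_algebra_bigcapT {T : Type} (G : set (set T)) (A : nat -> set T) :
  sigma_algebra setT G -> (forall t, G (A t)) -> G (\bigcap_t A t).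
Proof.
move=> [_ GC GU] GA.
have -> : \bigcap_t A t = setT `\` \bigcup_t (setT `\` A t).
  by rewrite !setTD setC_bigcup; apply: eq_bigcapr => t _; rewrite setTD setCK.
by apply: (GC); apply: GU => t; exact: GC.
Qed.

Definition history {T U : Type} (S : nat -> T -> U) (k : nat) (w : T)
    : {ffun 'I_k -> U} :=
  [ffun i : 'I_k => S i w].

(** The atom of the history is cut out by the first [k] draws, each constrained
to one value; draws from time [k] on are left free so as to write it as a
countable intersection. *)
Lemma sigma_of_history {disp} {T : measurableType disp} {U : finType}
    (S : nat -> T -> U) (J : set nat) (k : nat) (h : {ffun 'I_k -> U}) :
  `I_k `<=` J -> sigma_of J S (history S k @^-1` [set h]).
Proof.
move=> kJ.
pose A t := S t @^-1` (oapp (fun i => [set h i]) setT (insub t)).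
have -> : history S k @^-1` [set h] = \bigcap_t A t.
  apply/seteqP; split=> [w /= hw t _|w Aw].
    rewrite /A /=; case: insubP => [i ik it|] //=.
    by rewrite -hw ffunE -it.
  apply/ffunP => i; rewrite ffunE; have := Aw i Logic.I.
  by rewrite /A /= valK.
apply: sigma_algebra_bigcapT; first exact: smallest_sigma_algebra.
move=> t; rewrite /A; case: insubP => [i ik it|_] /=.
  apply: sub_sigma_algebra; exists t; first exact: kJ.
  by exists [set h i]; rewrite // setTI.
rewrite preimage_setT -(setD0 setT).
have [s0 sC _] := smallest_sigma_algebra setT
   (\bigcup_(j in J) preimage_set_system [set: T] (S j) [set: set U]).
by apply: sC.
Qed.

Lemma sigma_of_measurable {disp} {T : measurableType disp} {U : Type}
    (S : nat -> T -> U) (J : set nat) :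
  (forall j, discrete_rv (S j)) -> sigma_of J S `<=` measurable.
Proof.
move=> mS; apply: smallest_sub; first exact: sigma_algebra_measurable.
by move=> _ [j _] [B _ <-]; rewrite setTI; exact: mS.
Qed.

(** [miso_phi] reads a total sequence of draws; by [miso_phi_causal], the table
at any time up to [k] is the same for every way of extending the history. *)
Definition history_extension {U : Type} (u0 : U) {k} (h : {ffun 'I_k -> U})
    (t : nat) : U :=
  oapp h u0 (insub t).

Lemma history_extensionE {T U : Type} (u0 : U) (S : nat -> T -> U) k w t :
  (t < k)%N -> history_extension u0 (history S k w) t = S t w.
Proof.
by move=> tk; rewrite /history_extension insubT /= ffunE.
Qed.

Lemma miso_phi_causal {R : realType} {d n} (gamma : R)
    (fs : 'I_n -> 'rV[R]_d -> R) phi0 (S S' : nat -> {set 'I_n}) k :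
  (forall t, (t < k)%N -> S t = S' t) ->
  miso_phi gamma fs phi0 S k = miso_phi gamma fs phi0 S' k.
Proof.
elim: k => [//|k IH] SS' /=.
by rewrite IH ?SS' // => t tk; apply: SS'; exact: ltnW.
Qed.

Lemma expectation_of_history {disp} {T : measurableType disp} {R : realType}
    (P : probability T R) {U : finType} (S : nat -> T -> U) (k : nat)
    (g : {ffun 'I_k -> U} -> R) :
  (forall j, discrete_rv (S j)) ->
  'E_P[fun w => g (history S k w)]%E
    = (\sum_h g h * fine (P (history S k @^-1` [set h])))%:E.
Proof.
move=> mS; apply: expectation_finite_valued => h.
by apply: (@sigma_of_measurable _ _ _ S `I_k mS); exact: sigma_of_history.
Qed.

(** * The random trajectory of the method *)

Section miso_process.
Context {R : realType} {d n : nat} (gamma : R) (fs : 'I_n -> 'rV[R]_d -> R)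
  (phi0 : 'I_n -> 'rV[R]_d) {disp : measure_display} {T : measurableType disp}
  (P : probability T R) (S : nat -> T -> {set 'I_n}) (p : {set 'I_n} -> R)
  (Sp : independent_draws P p S).

Definition miso_memory j w := miso_phi gamma fs phi0 (fun t => S t w) j.

Definition memory_of_history {k} (j : nat) (h : {ffun 'I_k -> {set 'I_n}}) :=
  miso_phi gamma fs phi0 (history_extension finset.set0 h) j.

Let mS j : discrete_rv (S j). Proof. by have [] := Sp j. Qed.

Lemma miso_memory_history j k w : (j <= k)%N ->
  miso_memory j w = memory_of_history j (history S k w).
Proof.
move=> jk; apply: miso_phi_causal => t tj.
by rewrite history_extensionE // (leq_trans tj).
Qed.

Lemma expectation_memory (G : ('I_n -> 'rV[R]_d) -> R) j k : (j <= k)%N ->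
  'E_P[fun w => G (miso_memory j w)]%E
    = (\sum_h G (memory_of_history j h)
         * fine (P (history S k @^-1` [set h])))%:E.
Proof.
move=> jk.
rewrite -(expectation_of_history _ _ _ (G \o memory_of_history j) mS).
by congr expectation; apply/funext => w /=; rewrite (miso_memory_history j k).
Qed.

Lemma expectation_memory_subr (G : ('I_n -> 'rV[R]_d) -> R) (c : R) j :
  fine 'E_P[fun w => (G (miso_memory j w) - c)%R]
    = fine 'E_P[fun w => G (miso_memory j w)] - c.
Proof.
rewrite (expectation_memory (fun phi => G phi - c) j j) //.
rewrite (expectation_memory G j j) //=.
under eq_bigr do rewrite mulrBl.
rewrite sumrB; congr (_ - _).
have := expectation_memory (fun=> c) j j (leqnn j).
by rewrite expectation_cst => -[<-].
Qed.

(** Conditioning on the past: the draw at time [j] is averaged out over its law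
with the table [miso_memory j] held fixed. *)
Lemma expectation_memory_succ (G : ('I_n -> 'rV[R]_d) -> R) j :
  'E_P[fun w => G (miso_memory j.+1 w)]%E
    = 'E_P[fun w =>
        (\sum_s p s * G (miso_step gamma fs (miso_memory j w) s))%R]%E.
Proof.
have [_ lawS indS] := Sp j.
pose g s (h : {ffun 'I_j -> {set 'I_n}}) :=
  G (miso_step gamma fs (memory_of_history j h) s).
transitivity ('E_P[fun w => g (S j w) (history S j w)])%E.
  by congr expectation; apply/funext => w; rewrite /g -miso_memory_history.
rewrite (expectation_independent P (S j) (history S j) p _ g (mS j) lawS indS).
- congr expectation; apply/funext => w; apply: eq_bigr => s _.
  by rewrite /g -miso_memory_history.
- exact: sigma_of_measurable.
- by move=> h; exact: sigma_of_history.
Qed.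

Lemma expected_memory_descent (V D : ('I_n -> 'rV[R]_d) -> R) (eta : R) j :
  (forall phi,
     \sum_s p s * V (miso_step gamma fs phi s) <= V phi - eta * D phi) ->
  fine 'E_P[fun w => V (miso_memory j.+1 w)]
    <= fine 'E_P[fun w => V (miso_memory j w)]
       - eta * fine 'E_P[fun w => D (miso_memory j w)].
Proof.
move=> VD; rewrite expectation_memory_succ.
rewrite (expectation_memory
  (fun phi => \sum_s p s * V (miso_step gamma fs phi s)) j j) //.
rewrite !(expectation_memory _ j j) //= mulr_sumr -sumrB.
apply: ler_sum => h _; rewrite mulrA -mulrBl; apply: ler_wpM2r => //.
exact: fine_ge0.
Qed.

Lemma expectation_memory_ge0 (V : ('I_n -> 'rV[R]_d) -> R) j :
  (forall phi, 0 <= V phi) -> 0 <= fine 'E_P[fun w => V (miso_memory j w)].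
Proof. by move=> V0; apply: fine_ge0; exact: expectation_ge0. Qed.

Lemma expectation_uniform_memory (G : ('I_n -> 'rV[R]_d) -> R) k
    (a : T -> 'I_k.+1) :
  discrete_rv a -> has_law P a (@uniform_index R k) ->
  independent_of P a (sigma_of [set: nat] S) ->
  'E_P[fun w => G (miso_memory (a w) w)]%E
    = (k.+1%:R^-1
       * \sum_(j < k.+1) fine 'E_P[fun w => G (miso_memory j w)])%:E.
Proof.
move=> ma lawa inda.
pose g (i : 'I_k.+1) (h : {ffun 'I_k -> {set 'I_n}}) :=
  G (memory_of_history i h).
transitivity ('E_P[fun w => g (a w) (history S k w)])%E.
  congr expectation; apply/funext => w.
  by rewrite /g -miso_memory_history // -ltnS.
rewrite (expectation_independent P a (history S k) _ _ g ma lawa inda).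
- rewrite (expectation_of_history P S k
    (fun h => \sum_u uniform_index R u * g u h) mS).
  congr (_%:E); under eq_bigr do rewrite mulr_suml.
  rewrite exchange_big mulr_sumr; apply: eq_bigr => i _.
  rewrite (expectation_memory G i k) /=; last by rewrite -ltnS.
  by rewrite mulr_sumr; apply: eq_bigr => h _; rewrite mulrA.
- exact: sigma_of_measurable.
- by move=> h; exact: sigma_of_history.
Qed.

End miso_process.

(** * The complexity bound *)

Lemma sum_le_of_descent {R : realFieldType} (V D : nat -> R) (eta : R) :
  (forall j, V j.+1 <= V j - eta * D j) ->
  forall m, eta * \sum_(j < m) D j <= V 0%N - V m.
Proof.
move=> VD; elim=> [|m IH]; first by rewrite big_ord0 mulr0 subrr.
rewrite big_ord_recr mulrDr /=; have := VD m; lra.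
Qed.

Lemma miso_lyapunov_ge0 {R : realType} {d n : nat} (gamma B : R)
    (fs : 'I_n -> 'rV[R]_d -> R) (xs : 'rV[R]_d) (phi : 'I_n -> 'rV[R]_d) :
  0 <= B -> 0 <= miso_lyapunov gamma B fs xs phi.
Proof.
move=> B0; apply: addr_ge0; first exact: sqr_ge0.
by apply: mulr_ge0 => //; apply: sumr_ge0 => i _; exact: sqr_ge0.
Qed.

Theorem corollary5p6 (R : realType) (d n : nat) (hn : (2 <= n)%N)
    (fs : 'I_n -> 'rV[R]_d -> R) (f : 'rV[R]_d -> R) (hf : f = average fs)
    (Lf L : R)
    (hf_convex : convex_function [set: 'rV[R]_d] f) (hf_smooth : smooth Lf f)
    (xs : 'rV[R]_d) (hxs : forall x, f xs <= f x)
    (hfs_convex : forall i, convex_function [set: 'rV[R]_d] (fs i))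
    (hfs_smooth : forall i, smooth L (fs i))
    (tau : nat) (htau : (1 <= tau <= n)%N)
    (M : R)
    (hM : M = Lf + 4 * L / tau%:R * ((n%:R - tau%:R) / (n%:R - 1)))
    (hM_gt0 : 0 < M)
    (gamma : R) (hgamma : gamma = n%:R / (2 * tau%:R * M))
    (phi0 : 'I_n -> 'rV[R]_d)
    (disp : measure_display) (T : measurableType disp) (P : probability T R)
    (S : nat -> T -> {set 'I_n})
    (hS : independent_draws P (@nice_sampling R n tau) S)
    (x : nat -> T -> 'rV[R]_d)
    (hx : forall j w, x j w = miso_x gamma fs phi0 (fun t => S t w) j)
    (x0 : 'rV[R]_d) (hx0 : x0 = miso_point gamma fs phi0)
    (A : R) (hA : A = n%:R * (n%:R - tau%:R) / (tau%:R * (n%:R - 1)))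
    (W0 : R) (hW0 : W0 = miso_W gamma fs phi0 xs)
    (k : nat)
    (a : T -> 'I_k.+1) (ha : discrete_rv a)
    (ha_uniform : has_law P a (@uniform_index R k))
    (ha_indep : independent_of P a (sigma_of [set: nat] S))
    (eps : R) (heps : 0 < eps)
    (hk : 2 * M * ((enorm (x0 - xs) ^+ 2
                    + 2 * A * tau%:R / n%:R ^+ 3 * W0) / eps) <= k%:R) :
  ('E_P[fun w => f (x (a w) w)] - (f xs)%:E <= eps%:E)%E.
Proof.
pose N := n%:R : R; pose t := tau%:R : R.
have /andP[tau1 taun] := htau.
have N2 : 2 <= N by rewrite /N ler_nat.
have tN : t <= N by rewrite /N /t ler_nat.
have T1 : 1 <= t by rewrite /t (ler_nat _ 1).
pose B := 2 * (N - t) / (N ^+ 2 * (N - 1)).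
have BE : 2 * A * t / N ^+ 3 = B.
  by rewrite hA /B -/N -/t; field; rewrite !gt_eqF //; lra.
have B0 : 0 <= B by rewrite divr_ge0 // ?mulr_ge0 // ?exprn_ge0 //; lra.
pose F phi := f (miso_point gamma fs phi).
pose V := miso_lyapunov gamma B fs xs.
pose m := miso_memory gamma fs phi0 S.
pose EF j := fine 'E_P[fun w => F (m j w)]%E.
pose EV j := fine 'E_P[fun w => V (m j w)]%E.
have V0 : EV 0%N = enorm (x0 - xs) ^+ 2 + B * W0.
  by rewrite /EV /m /miso_memory /= expectation_cst /= hx0 hW0.
have descent_step j : EV j.+1 <= EV j - (2 * M)^-1 * (EF j - f xs).
  have -> : EF j - f xs = fine 'E_P[fun w => (F (m j w) - f xs)%R]%E.
    by rewrite (expectation_memory_subr _ _ _ _ _ _ hS).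
  apply: (expected_memory_descent _ _ _ _ _ _ hS V
    (fun phi => F phi - f xs)) => phi.
  rewrite /F /V hf.
  by apply: (miso_expected_descent fs Lf L xs tau M gamma B phi); rewrite -?hf.
have tele := sum_le_of_descent EV (fun j => EF j - f xs) _ descent_step k.+1.
have Vk : 0 <= EV k.+1.
  by apply: expectation_memory_ge0 => phi; exact: miso_lyapunov_ge0.
have -> : 'E_P[fun w => f (x (a w) w)]%E = 'E_P[fun w => F (m (a w) w)]%E.
  by congr expectation; apply/funext => w; rewrite hx.
have -> : 'E_P[fun w => F (m (a w) w)]%E
    = (k.+1%:R^-1 * \sum_(j < k.+1) EF j)%:E.
  by exact: (expectation_uniform_memory _ _ _ _ _ _ hS).
rewrite -EFinB lee_fin.
have {}tele : (2 * M)^-1 * (\sum_(j < k.+1) EF j - f xs * k.+1%:R)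
    <= EV 0%N - EV k.+1.
  by move: tele; rewrite sumrB sumr_const card_ord -(mulr_natr (f xs)).
move: hk tele Vk; rewrite -/t -/N BE -V0.
generalize (EV 0%N) (EV k.+1) (\sum_(j < k.+1) EF j) (f xs)
  => v w s c hk tele w0.
have M2 : 0 < 2 * M by rewrite mulr_gt0.
have {}hk : 2 * M * v <= k%:R * eps.
  by rewrite -ler_pdivrMr // -(mulrA (2 * M)).
have {}tele : s - c * k.+1%:R <= 2 * M * v.
  by rewrite -ler_pdivrMl //; apply: (le_trans tele); rewrite gerBl.
rewrite lerBlDr ler_pdivrMl ?ltr0n // mulrDr (mulrC _ c) -lerBlDr.
apply: (le_trans tele); apply: (le_trans hk).
by rewrite ler_pM2r // ler_nat.
Qed.
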